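(* Let $\gamma\in(0,1)$, let $V_\phi:\mathcal{S}\to\mathbb{R}$ be a function, and let $k_\psi:\mathcal{Z}\times\mathcal{Z}\to\mathbb{R}$ be a bounded positive definite kernel on $\mathcal{Z}=\mathcal{S}\times\mathcal{A}$. Suppose that the variables $R_t(e)$, indexed by episodes $e$ and times $t\ge 0$, follow a Gaussian process (i.e. are jointly Gaussian) with \[ \mathbb{E}_{\mathcal{GP}}[R_t(e)]=V_\phi(s_t),\qquad \mathrm{Cov}_{\mathcal{GP}}\left(R_t(e),R_u(e')\right)=k_\psi(z_t,z'_u) \] for all episodes $e=(z_t)_{t\ge0}=(s_t,a_t)_{t\ge 0}$, $e'=(z'_u)_{u\ge0}$ and all times $t,u$. Let $\hat{A}_t(e):=R_t(e)-V_\phi(s_t)$. Then the functional \[ \hat{F}(e)=\sum_{t\ge0}\gamma^t\hat{A}_t(e) \] (with the sum converging in $L^2(\mathcal{GP})$ when the episode is infinite) follows a centered Gaussian process, indexed by episodes, with covariance kernel \[ K(e,e')=\sum_{t,u\ge0}\gamma^{t+u}k_\psi(z_t,z'_u), \] for episodes $e=(z_t)_{t\ge0}$, $e'=(z'_u)_{u\ge0}$.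
   Context: $\mathcal{S}$ (states) and $\mathcal{A}$ (actions) are sets, and $\mathcal{Z}:=\mathcal{S}\times\mathcal{A}$. An episode is a sequence $e=(z_t)_{t\ge0}$ with $z_t=(s_t,a_t)\in\mathcal{Z}$, which may be finite or infinite; for a finite episode, all sums over $t\ge 0$ range only over the times $t$ at which the episode is defined. $\gamma$ is a discount rate. In this model the discounted returns $R_t(e)$ are treated as real random variables indexed by pairs (episode, time), and ''follow a Gaussian process'' means that any finite subfamily is (possibly degenerate) multivariate normal with the indicated means and covariances. $\mathbb{E}_{\mathcal{GP}}$ and $\mathrm{Cov}_{\mathcal{GP}}$ denote expectation and covariance under this model. A Gaussian process is centered if its mean function is identically zero. ''Positive definite kernel'' means symmetric with all Gram matrices positive semidefinite; bounded means bounded as a function on $\mathcal{Z}\times\mathcal{Z}$. $L^2(\mathcal{GP})$ is the completion of $\mathrm{span}\{\hat{A}_t(e)\}$ (over all episodes $e$ and times $t$) with respect to the norm $\|X\|_{L^2(\mathcal{GP})}=\mathbb{E}_{\mathcal{GP}}[X^2]^{1/2}$. *)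

(* Defs.v *)
From mathcomp Require Import all_boot all_order all_algebra.
From mathcomp Require Import all_classical all_reals.
From mathcomp Require Import topology normedtype ereal sequences numfun esum measure.
From mathcomp Require Import lebesgue_stieltjes_measure lebesgue_measure.
From mathcomp Require Import measurable_realfun lebesgue_integral hoelder.
From mathcomp Require Import random_variable normal_distribution.
Set Implicit Arguments.
Unset Strict Implicit.
Unset Printing Implicit Defensive.
Import Order.TTheory GRing.Theory Num.Theory.
Import numFieldNormedType.Exports.
Local Open Scope classical_set_scope.
Local Open Scope ring_scope.

Section episodes.
Variable Z : Type.

Inductive episode := Finite of seq Z | Infinite of (nat -> Z).

Definition time (e : episode) : countType :=
  match e with Finite s => 'I_(size s) | Infinite _ => nat end.

Definition time_val (e : episode) : time e -> nat :=
  match e with Finite _ => fun t => nat_of_ord t | Infinite _ => fun t => t end.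

Definition step (e : episode) : time e -> Z :=
  match e with Finite s => fun t => tnth (in_tuple s) t | Infinite z => z end.

Definition moment := {e : episode & time e}.

Definition step_at (i : moment) : Z := step (tagged i).

End episodes.

Definition positive_definite_kernel (R : realType) (Z : Type)
    (k : Z -> Z -> R) :=
  (forall z z', k z z' = k z' z) /\
  (forall (n : nat) (z : 'I_n -> Z) (c : 'I_n -> R),
      0 <= \sum_(i < n) \sum_(j < n) c i * c j * k (z i) (z j)).

Section gaussian.
Context (R : realType) (d : measure_display) (T : measurableType d).
Variable P : probability T R.

(* [normal_prob m 0] is not the Dirac mass at m, hence the case split; two
   laws need only be compared on measurable sets. *)
Definition normal_law (X : {RV P >-> R}) :=
  exists m s : R, forall B : set R, measurable B ->
    distribution P X B = if s == 0 then \d_m B else normal_prob m s B.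

(* Possibly degenerate: every linear combination is normal, and the mean vector
   and covariance matrix are mu and Sigma. *)
Definition multivariate_normal (n : nat) (X : 'I_n -> {RV P >-> R})
    (mu : 'I_n -> R) (Sigma : 'I_n -> 'I_n -> R) :=
  [/\ forall a : 'I_n -> R, normal_law (\sum_(i < n) a i *: X i),
      forall i, ('E_P[X i] = (mu i)%:E)%E &
      forall i j, covariance P (X i) (X j) = (Sigma i j)%:E].

Definition gaussian_process (I : Type) (X : I -> {RV P >-> R})
    (mu : I -> R) (C : I -> I -> R) :=
  forall (n : nat) (i : 'I_n -> I),
    multivariate_normal (fun j => X (i j)) (fun j => mu (i j))
      (fun j l => C (i j) (i l)).

Definition L2norm (X : {RV P >-> R}) : \bar R := 'N[P]_2%:E[EFin \o X]%E.

(* The completion, in L^2(P), of the linear span of the X i; random variables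
   stand for their a.e. classes. *)
Definition L2_closed_span (I : Type) (X : I -> {RV P >-> R}) :
    set {RV P >-> R} :=
  [set Y : {RV P >-> R} | (Y : T -> R) \in Lfun P 2%:E /\
     forall eps : R, 0 < eps ->
       exists (n : nat) (a : 'I_n -> R) (i : 'I_n -> I),
         (L2norm (Y - \sum_(j < n) a j *: X (i j))%R < eps%:E)%E].

(* [discounted_sum gamma A Y]: Y is (a version of) the sum over the times t of e
   of gamma ^ t A_t, in the L^2 sense when e is infinite. *)
Definition discounted_sum (Z : Type) (gamma : R) (e : episode Z) :
    (time e -> {RV P >-> R}) -> {RV P >-> R} -> Prop :=
  match e return (time e -> {RV P >-> R}) -> {RV P >-> R} -> Prop with
  | Finite s => fun (A : 'I_(size s) -> _) Y =>
      (Y : T -> R) = (\sum_(t < size s) gamma ^+ t *: A t : {RV P >-> R})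
        %[ae P]
  | Infinite _ => fun (A : nat -> _) Y =>
      L2norm (\sum_(t < n) gamma ^+ t *: A t - Y) @[n --> \oo]
        --> 0%E
  end.

Definition advantage (S A : Type) (V : S -> R)
    (Ret : forall e : episode (S * A), time e -> {RV P >-> R})
    (e : episode (S * A)) (t : time e) : {RV P >-> R} :=
  Ret e t - (cst (V (step t).1) : {mfun T >-> R}).

End gaussian.

Section covariance_kernel.
Context (R : realType) (Z : Type).
Variables (gamma : R) (k : Z -> Z -> R).

Definition discounted_term (e e' : episode Z) (tu : time e * time e') : R :=
  gamma ^+ (time_val tu.1 + time_val tu.2) * k (step tu.1) (step tu.2).

(* Sum of an absolutely summable double family; [esum] is only meaningful on
   nonnegative terms. *)
Definition discounted_kernel (e e' : episode Z) : R :=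
  fine (esum [set: time e * time e'] (EFin \o @discounted_term e e')^\+ -
        esum [set: time e * time e'] (EFin \o @discounted_term e e')^\-)%E.

End covariance_kernel.

(* Main.v *)
From HB Require Import structures.
Require Import Defs.
From mathcomp Require Import all_boot all_order all_algebra.
From mathcomp Require Import all_classical all_reals.
From mathcomp Require Import topology normedtype ereal sequences numfun esum measure.
From mathcomp Require Import lebesgue_stieltjes_measure lebesgue_measure.
From mathcomp Require Import measurable_realfun lebesgue_integral hoelder.
From mathcomp Require Import random_variable normal_distribution.
From mathcomp Require Import ring lra.
From mathcomp Require Import exp derive realfun ftc.
Import Order.TTheory GRing.Theory Num.Theory.
Import numFieldNormedType.Exports.
Local Open Scope classical_set_scope.
Local Open Scope ring_scope.

(** Let S_N(e) be the N-th partial sum of the series of the gamma^t A_t(e).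
    Since E[A_t^2] = k(z_t, z_t) is bounded, the series converges absolutely in
    L^2; it then converges almost everywhere, and Fatou's lemma identifies the
    pointwise limit with an L^2 limit.  By continuity of the inner product, means
    and covariances are limits of those of the S_N, and the covariances of the
    S_N are the square partial sums of an absolutely summable double series.

    It remains to see that an L^2 limit X of normal variables X_n is normal.
    The law of X_n is the image of N(0,1) under x |-> m_n + s_n x with s_n >= 0.
    With b and v the mean and the variance of N(0,1), E X_n = m_n + s_n b and
    Var X_n = s_n^2 v; as v > 0, convergence of the means and variances of the
    X_n forces that of m_n and s_n (the values b = 0 and v = 1 are irrelevant).
    Integrals of Lipschitz ramps then identify the law of X with the image of
    N(0,1) under the limiting affine map. *)

Set Implicit Arguments.
Unset Strict Implicit.

(** * The inner product of L2 *)

Lemma cvg_dist_le (R : realType) (u v : nat -> R) (a : R) :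
  (forall n, `|u n - a| <= v n) -> v n @[n --> \oo] --> 0 -> u n @[n --> \oo] --> a.
Proof.
move=> uv /cvgrPdist_le v0; apply/cvgrPdist_le => e /v0; apply: filterS => n.
by rewrite sub0r normrN distrC => h; rewrite (le_trans (uv n))// (le_trans (ler_norm _)).
Qed.

Section L2_space.
Context {R : realType} {d : measure_display} {T : measurableType d}.
Variable P : probability T R.
Implicit Types f g h : T -> R.

Let le12 : (1 <= 2%:E :> \bar R)%E.
Proof. by rewrite lee1n. Qed.
#[local] Hint Resolve le12 : core.

(** [fine] sends infinite values to 0, so [nrm] and [ip] are the L^2 norm and inner product only on
    [Lfun P 2%:E]; hence the membership hypotheses below. *)
Definition nrm f : R := fine 'N[P]_2%:E[EFin \o f]%E.
Definition ip f g : R := fine 'E_P[f \* g]%E.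

Lemma PTfin : P setT \is a fin_num.
Proof. exact: fin_num_measure. Qed.

Lemma L2_measurable f : f \in Lfun P 2%:E -> measurable_fun setT f.
Proof. by case/andP => /[!inE]. Qed.

Lemma L2_Lfun1 f : f \in Lfun P 2%:E -> f \in Lfun P 1.
Proof. exact: (Lfun_subset12 PTfin). Qed.

Lemma nrm_fin f : f \in Lfun P 2%:E -> 'N[P]_2%:E[EFin \o f]%E = (nrm f)%:E.
Proof.
case/andP => _ /[!inE] /= h; rewrite /nrm fineK//.
by rewrite ge0_fin_numE ?Lnorm_ge0.
Qed.

Lemma nrm_ge0 f : 0 <= nrm f.
Proof. exact/fine_ge0/Lnorm_ge0. Qed.

Lemma ip_fin f g : f \in Lfun P 2%:E -> g \in Lfun P 2%:E ->
  'E_P[f \* g]%E = (ip f g)%:E.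
Proof. by move=> fL gL; rewrite /ip fineK// expectation_fin_num// Lfun2_mul_Lfun1. Qed.

Lemma ipC f g : ip f g = ip g f.
Proof. by rewrite /ip; congr (fine (expectation _ _)); apply/funext => x /=; rewrite mulrC. Qed.

Lemma ipDl f g h : f \in Lfun P 2%:E -> g \in Lfun P 2%:E -> h \in Lfun P 2%:E ->
  ip (f + g) h = ip f h + ip g h.
Proof.
move=> fL gL hL; apply: EFin_inj; rewrite EFinD -!ip_fin ?rpredD//.
rewrite -expectationD ?Lfun2_mul_Lfun1//.
by have -> : (f + g) \* h = f \* h \+ g \* h by apply/funext => x /=; rewrite -mulrDl.
Qed.

Lemma ipZl a f g : f \in Lfun P 2%:E -> g \in Lfun P 2%:E ->
  ip (a *: f) g = a * ip f g.
Proof.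
move=> fL gL; apply: EFin_inj; rewrite EFinM -!ip_fin ?rpredZ//.
rewrite -expectationZl ?Lfun2_mul_Lfun1//.
have -> // : (a *: f) \* g = a \o* (f \* g).
by apply/funext => x /=; rewrite mulrC [RHS]mulrC [RHS]mulrA mulrC.
Qed.

Lemma ipDr f g h : f \in Lfun P 2%:E -> g \in Lfun P 2%:E -> h \in Lfun P 2%:E ->
  ip h (f + g) = ip h f + ip h g.
Proof. by move=> *; rewrite ipC ipDl// !(ipC h). Qed.

Lemma ipZr a f g : f \in Lfun P 2%:E -> g \in Lfun P 2%:E ->
  ip g (a *: f) = a * ip g f.
Proof. by move=> *; rewrite ipC ipZl// ipC. Qed.

Lemma ipBl f g h : f \in Lfun P 2%:E -> g \in Lfun P 2%:E -> h \in Lfun P 2%:E ->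
  ip (f - g) h = ip f h - ip g h.
Proof.
by move=> fL gL hL; rewrite -scaleN1r ipDl ?ipZl ?mulN1r// rpredZ.
Qed.

Lemma ipBr f g h : f \in Lfun P 2%:E -> g \in Lfun P 2%:E -> h \in Lfun P 2%:E ->
  ip h (f - g) = ip h f - ip h g.
Proof. by move=> *; rewrite ipC ipBl// !(ipC h). Qed.

Lemma ip_suml (I : Type) (r : seq I) (f : I -> T -> R) g :
  (forall i, f i \in Lfun P 2%:E) -> g \in Lfun P 2%:E ->
  ip (\sum_(i <- r) f i) g = \sum_(i <- r) ip (f i) g.
Proof.
move=> fL gL; elim: r => [|i r IH].
  by rewrite !big_nil -[X in ip X](scale0r (0 : T -> R)) ipZl ?mul0r// rpred0.
by rewrite !big_cons ipDl ?IH// rpred_sum.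
Qed.

Lemma ip_sumr (I : Type) (r : seq I) (f : I -> T -> R) g :
  (forall i, f i \in Lfun P 2%:E) -> g \in Lfun P 2%:E ->
  ip g (\sum_(i <- r) f i) = \sum_(i <- r) ip g (f i).
Proof. by move=> fL gL; rewrite ipC ip_suml//; under eq_bigr do rewrite ipC. Qed.

Lemma ip_cst1 f : ip f (cst 1) = fine 'E_P[f]%E.
Proof. by rewrite /ip; have -> // : f \* cst 1 = f; apply/funext => x /=; rewrite mulr1. Qed.

Lemma nrm_sqr f : f \in Lfun P 2%:E -> nrm f ^+ 2 = ip f f.
Proof.
move=> fL; apply: EFin_inj; rewrite -ip_fin//.
have := @poweR_Lnorm _ _ _ P (EFin \o f) 2 (negbT (gt_eqF (ltr0n _ 2))).
rewrite nrm_fin// poweR_EFin powR_mulrn ?nrm_ge0// => ->; rewrite unlock; apply: eq_integral => x _.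
by rewrite poweR_EFin powR_mulrn// real_normK ?num_real// expr2.
Qed.

(** Hölder's inequality with exponents 2 and 2, after bounding the modulus of the integral by the
    integral of the modulus. *)
Lemma ip_CS f g : f \in Lfun P 2%:E -> g \in Lfun P 2%:E ->
  `|ip f g| <= nrm f * nrm g.
Proof.
move=> fL gL; rewrite -lee_fin EFinM -!nrm_fin//.
have := @hoelder _ _ _ P f g 2 2 (L2_measurable fL) (L2_measurable gL).
have -> : (2^-1 + 2^-1 = 1 :> R)%R by rewrite [RHS]splitr !div1r.
move=> /(_ (ltr0n _ 2) (ltr0n _ 2) erefl); apply: le_trans.
rewrite Lnorm1 -abse_EFin -ip_fin// unlock; apply: le_abse_integral => //.
by apply/measurable_EFinP/measurable_funM; exact: L2_measurable.
Qed.

Lemma nrmD f g : f \in Lfun P 2%:E -> g \in Lfun P 2%:E -> nrm (f + g) <= nrm f + nrm g.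
Proof.
move=> fL gL; rewrite -lee_fin EFinD -!nrm_fin ?rpredD//.
by apply: eminkowski => //; exact: L2_measurable.
Qed.

Lemma nrmZ a f : f \in Lfun P 2%:E -> nrm (a *: f) = `|a| * nrm f.
Proof.
move=> fL; apply/eqP; rewrite -(@eqrXn2 _ 2) ?mulr_ge0 ?nrm_ge0//.
by rewrite exprMn !nrm_sqr ?rpredZ// ipZl ?ipZr ?rpredZ// mulrA -expr2 real_normK ?num_real.
Qed.

Lemma nrm_sum (I : Type) (r : seq I) (f : I -> T -> R) :
  (forall i, f i \in Lfun P 2%:E) ->
  nrm (\sum_(i <- r) f i) <= \sum_(i <- r) nrm (f i).
Proof.
move=> fL; elim: r => [|i r IH].
  by rewrite !big_nil -[X in nrm X](scale0r (0 : T -> R)) nrmZ ?normr0 ?mul0r ?rpred0.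
by rewrite !big_cons; apply: le_trans (nrmD _ _) _; rewrite ?rpred_sum// lerD2l.
Qed.

Lemma cst_L2 (c : R) : (cst c : T -> R) \in Lfun P 2%:E.
Proof. exact: Lfun_cst. Qed.

Lemma ip_cvg (f_ g_ : nat -> T -> R) f g :
  (forall n, f_ n \in Lfun P 2%:E) -> (forall n, g_ n \in Lfun P 2%:E) ->
  f \in Lfun P 2%:E -> g \in Lfun P 2%:E ->
  nrm (f_ n - f) @[n --> \oo] --> 0 -> nrm (g_ n - g) @[n --> \oo] --> 0 ->
  ip (f_ n) (g_ n) @[n --> \oo] --> ip f g.
Proof.
move=> fnL gnL fL gL cf cg.
(* Split <f_n, g_n> - <f, g> as <f_n - f, g_n> + <f, g_n - g>, then use Cauchy-Schwarz and the
   triangle inequality for the norm of g_n. *)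
pose v n := nrm (f_ n - f) * (nrm (g_ n - g) + nrm g) + nrm f * nrm (g_ n - g).
apply: (@cvg_dist_le _ _ v).
  move=> n; have fL' : f_ n - f \in Lfun P 2%:E by rewrite rpredB.
  have gL' : g_ n - g \in Lfun P 2%:E by rewrite rpredB.
  have -> : ip (f_ n) (g_ n) - ip f g = ip (f_ n - f) (g_ n) + ip f (g_ n - g).
    by rewrite ipBl// ipBr// addrA subrK.
  apply: le_trans (ler_normD _ _) _; apply: lerD; last exact: ip_CS.
  apply: le_trans (ip_CS _ _) _ => //; apply: ler_wpM2l; rewrite ?nrm_ge0//.
  by rewrite -[X in nrm X <= _](subrK g); apply: nrmD.
have -> : (0 : R) = 0 * (0 + nrm g) + nrm f * 0 by rewrite mul0r mulr0 addr0.
apply: cvgD; apply: cvgM => //; last exact: cvg_cst.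
by apply: cvgD => //; exact: cvg_cst.
Qed.

Lemma ip_cvgl (f_ : nat -> T -> R) f h :
  (forall n, f_ n \in Lfun P 2%:E) -> f \in Lfun P 2%:E -> h \in Lfun P 2%:E ->
  nrm (f_ n - f) @[n --> \oo] --> 0 -> ip (f_ n) h @[n --> \oo] --> ip f h.
Proof.
move=> fnL fL hL c; apply: ip_cvg => //.
have -> : nrm (h - h) = 0.
  by rewrite subrr -(scale0r (0 : T -> R)) nrmZ ?rpred0// normr0 mul0r.
exact: cvg_cst.
Qed.

(** Convergence to 0 of the extended norms makes some distance from f_N to f finite; then f = f_N -
    (f_N - f) is a difference of L^2 functions. *)
Lemma L2_limit (f_ : nat -> T -> R) f : measurable_fun setT f ->
  (forall n, f_ n \in Lfun P 2%:E) ->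
  'N[P]_2%:E[EFin \o (f_ n - f)%R]%E @[n --> \oo] --> 0%E ->
  f \in Lfun P 2%:E /\ nrm (f_ n - f) @[n --> \oo] --> 0.
Proof.
move=> mf fnL c; split; last first.
  by rewrite /nrm; apply: fine_cvg.
have [N _ /(_ N (leqnn N)) fin] : \forall n \near \oo,
    'N[P]_2%:E[EFin \o (f_ n - f)%R]%E \is a fin_num.
  by case/fine_cvgP : c.
have dL : f_ N - f \in Lfun P 2%:E.
  apply/andP; split; rewrite inE /=.
    by apply: measurable_funB => //; exact: L2_measurable.
  by rewrite /finite_norm ltey_eq fin.
have -> : f = f_ N - (f_ N - f) by rewrite opprB addrC subrK.
by rewrite rpredB.
Qed.

Lemma nrm_cst1 : nrm (cst 1 : T -> R) = 1.
Proof.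
apply/eqP; rewrite -(@eqrXn2 _ 2) ?nrm_ge0//.
by rewrite nrm_sqr ?cst_L2// ip_cst1 expectation_cst expr1n.
Qed.

Lemma integrable_L2 f : f \in Lfun P 2%:E <->
  measurable_fun setT f /\ P.-integrable setT (EFin \o (fun x => f x ^+ 2)).
Proof.
split=> [fL|[mf /integrableP[_ fi]]].
  by split; [exact: L2_measurable|exact: Lfun2_integrable_sqr].
apply/andP; split; rewrite inE//= /finite_norm unlock poweR_lty//.
apply: le_lt_trans fi; under eq_integral do rewrite poweR_EFin powR_mulrn// -normrX.
by [].
Qed.
End L2_space.
#[global] Hint Extern 0 (is_true (1 <= 2%:E)%E) => exact: lee1n : core.

(** * Normal laws as affine images of the standard normal law *)

(** The two probability spaces may differ, so a variable on P can be compared with a map on the line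
    carrying N(0,1). *)
Definition eq_law {R : realType} {d d' : measure_display} {T : measurableType d}
    {U : measurableType d'} {P : probability T R} {Q : probability U R}
    (X : {RV P >-> R}) (Y : {RV Q >-> R}) :=
  forall B : set R, measurable B -> distribution P X B = distribution Q Y B.

(** The half-lines [a, +oo[ generate the Borel sets, are stable under intersection, and cover the
    line as a = -k decreases; finite measures agreeing on them coincide. *)
Lemma eq_law_itvcy {R : realType} {d d' : measure_display} {T : measurableType d}
    {U : measurableType d'} {P : probability T R} {Q : probability U R}
    (X : {RV P >-> R}) (Y : {RV Q >-> R}) :
  (forall a : R, distribution P X `[a, +oo[%classic = distribution Q Y `[a, +oo[%classic) ->
  eq_law X Y.
Proof.
move=> XY B mB.
refine (@measure_unique _ R R (@RGenCInfty.G R)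
  (fun k : nat => `[- (k%:R : R), +oo[%classic) _ _ _ _ (distribution P X)
  (distribution Q Y) _ _ B mB).
- exact: RGenCInfty.measurableE.
- move=> _ _ [x ->] [y ->]; exists (Num.max x y).
  by apply/seteqP; split=> z /=; rewrite !in_itv/= !andbT ge_max => /andP.
- by move=> i; exists (- i%:R).
- apply/seteqP; split=> // x _; exists (Num.truncn `|x|).+1 => //=.
  rewrite in_itv/= andbT lerNl (le_trans (ler_norm _))// normrN ltW//.
  exact: truncnS_gt.
- by move=> _ [a ->]; exact: XY.
- by move=> k; rewrite (le_lt_trans (probability_le1 _ _))// ltry.
Qed.

Section normal_affine.
Context {R : realType}.

Definition affine (m s : R) : measurableTypeR R -> R :=
  fun x => m + s * x.

Lemma measurable_affine (m s : R) : measurable_fun setT (affine m s).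
Proof. by apply: measurable_funD => //; exact: measurable_funM. Qed.

HB.instance Definition _ (m s : R) :=
  isMeasurableFun.Build _ _ _ _ (affine m s) (measurable_affine m s).

Lemma affine01 : affine 0 1 = id.
Proof. by apply/funext => x; rewrite /affine mul1r add0r. Qed.

(** The density sees s only through s ^+ 2 and the test s == 0. This allows s to be taken
    nonnegative. *)
Lemma normal_probN (m s : R) : normal_prob m (- s) = normal_prob m s.
Proof.
by rewrite /normal_prob /normal_pdf /normal_peak /normal_fun oppr_eq0 sqrrN.
Qed.

Lemma normal_pdf_affine (m s x : R) : 0 < s ->
  normal_pdf m s (m + s * x) * s = normal_pdf 0 1 x.
Proof.
move=> s0; rewrite !normal_pdfE ?oner_eq0 ?gt_eqF//= /normal_peak /normal_fun.
rewrite mulrAC; congr (_ * expR _).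
  rewrite -mulrnAr sqrtrM ?sqr_ge0// sqrtr_sqr gtr0_norm// invfM expr1n mul1r.
  by rewrite mulrAC mulVf ?gt_eqF// mul1r.
rewrite [m + _]addrC addrK subr0 exprMn expr1n -(mulr_natr (s ^+ 2)) invfM !mulNr; congr (- _).
by rewrite mulrACA divff ?mul1r// sqrf_eq0 gt_eqF.
Qed.

(** By uniqueness on half-lines, this is the substitution y = m + s x in the integral of the density
    over [a, +oo[. *)
Lemma normal_prob_affine (m s : R) : 0 < s ->
  forall B : set R, measurable B ->
  normal_prob m s B = normal_prob 0 1 (affine m s @^-1` B).
Proof.
move=> s0; pose F : R -> R := affine m s.
have dF (x : R) : is_derive x (1 : R) F s.
  rewrite /F; by apply: is_derive_eq; rewrite add0r mul1r; exact: mulr1.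
have F'E : F^`()%classic = cst s by apply/funext => x; rewrite derive1E derive_val.
(* The measure on the left is viewed as the law of the identity [affine 0 1], so that [eq_law_itvcy]
   applies. *)
suff H : eq_law (affine 0 1 : {RV (normal_prob m s) >-> R})
    (affine m s : {RV (normal_prob 0 1) >-> R}).
  move=> B mB; rewrite -[B in LHS](preimage_id B) -affine01; exact: H.
apply: eq_law_itvcy => a; rewrite /distribution /pushforward.
transitivity (normal_prob m s `[a, +oo[%classic).
  by congr (normal_prob m s _); rewrite -[RHS]preimage_id -affine01.
transitivity (normal_prob 0 1 `[(a - m) / s, +oo[%classic); last first.
  congr (normal_prob 0 1 _); apply/seteqP; split=> x /=;
    by rewrite !in_itv/= !andbT ler_pdivrMr// lerBlDl mulrC.
(* The substitution rule expects the lower end point as a value of F. *)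
have {1}-> : a = F ((a - m) / s) by rewrite /F /affine mulrC divfK ?gt_eqF// addrC subrK.
have sub := @increasing_ge0_integration_by_substitutiony _ F
  (normal_pdf m s) ((a - m) / s).
apply: (etrans (sub _ _ _ _ _ _ _ _)) => {sub}.
- by move=> x y _ _ xy; rewrite /F /affine ltrD2l ltr_pM2l.
- by rewrite F'E => x _; exact: cst_continuous.
- by rewrite F'E; exact: is_cvg_cst.
- by rewrite F'E; exact: is_cvg_cst.
- split; first by move=> x _; exact: ex_derive.
  apply: cvg_at_right_filter; apply: differentiable_continuous.
  by apply/derivable1_diffP; exact: ex_derive.
- apply/cvgryPge => A; near=> x.
  by rewrite /F /affine -lerBlDl mulrC -ler_pdivrMr.
- by apply: continuous_subspaceT; apply: continuous_normal_pdf; rewrite gt_eqF.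
- by move=> x _; exact: normal_pdf_ge0.
- apply: eq_integral => x _; congr EFin.
  by rewrite F'E; exact: normal_pdf_affine.
Unshelve. all: by end_near. Qed.
End normal_affine.

(** * Integrals and moments determined by the law *)

Section eq_law.
Context {R : realType} {d d' : measure_display} {T : measurableType d}
  {U : measurableType d'} {P : probability T R} {Q : probability U R}.

Variables (X : {RV P >-> R}) (Y : {RV Q >-> R}).
Hypothesis XY : eq_law X Y.

Lemma eq_law_ge0_integral (f : R -> \bar R) : measurable_fun setT f ->
  (forall y, 0 <= f y)%E ->
  (\int[P]_x f (X x) = \int[Q]_y f (Y y))%E.
Proof.
move=> mf f0; rewrite -[LHS]ge0_integral_distribution// -[RHS]ge0_integral_distribution//.
by apply: eq_measure_integral => B mB _; exact: XY.
Qed.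

Lemma eq_law_L2 : (X : T -> R) \in Lfun P 2%:E -> (Y : U -> R) \in Lfun Q 2%:E.
Proof.
move=> /integrable_L2[_ /integrableP[_ iX]]; apply/integrable_L2; split => //.
apply/integrableP; split; first by apply/measurable_EFinP; exact: measurable_funX.
have := @eq_law_ge0_integral (fun y => `|(y ^+ 2)%:E|)%E.
by rewrite /= => <- //; apply/measurable_EFinP; apply: measurableT_comp.
Qed.

Lemma eq_law_expectation : (X : T -> R) \in Lfun P 2%:E ->
  'E_P[X]%E = 'E_Q[Y]%E.
Proof.
move=> XL; have YL := eq_law_L2 XL; rewrite unlock.
rewrite -[LHS](@integral_distribution _ _ _ _ _ P X EFin)//; last first.
  exact/Lfun1_integrable/L2_Lfun1.
rewrite -[RHS](@integral_distribution _ _ _ _ _ Q Y EFin)//; last first.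
  exact/Lfun1_integrable/L2_Lfun1.
by apply: eq_measure_integral => B mB _; exact: XY.
Qed.

Lemma eq_law_ip : ip P X X = ip Q Y Y.
Proof.
rewrite /ip unlock; congr fine.
apply: (@eq_law_ge0_integral (fun y => (y * y)%:E)).
  by apply/measurable_EFinP; exact: measurable_funM.
by move=> y; rewrite lee_fin -expr2 sqr_ge0.
Qed.

End eq_law.

(** * Normal laws as affine images, and the moments of N(0,1) *)

Section normal_law.
Context {R : realType} {d : measure_display} {T : measurableType d}.
Variable P : probability T R.
Let g : probability (measurableTypeR R) R := normal_prob (0 : R) 1.

(** A constant map pushes N(0,1) to a Dirac mass, so the affine form absorbs the case s = 0.
    Requiring s >= 0 makes s recoverable from the variance. *)
Lemma normal_lawP (X : {RV P >-> R}) : normal_law X <->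
  exists m s : R, 0 <= s /\ eq_law X (affine m s : {RV g >-> R}).
Proof.
have aff0 m (B : set R) : (\d_m B = distribution g (affine m 0) B :> \bar R)%E.
  rewrite /distribution /pushforward diracE.
  have [mB|mB] := boolP (m \in B).
    rewrite [X in g X](_ : _ = setT) ?probability_setT//.
    by apply/seteqP; split=> // x _; rewrite /= /affine mul0r addr0; exact: set_mem.
  rewrite [X in g X](_ : _ = set0) ?measure0//.
  apply/seteqP; split=> // x; rewrite /= /affine mul0r addr0 => Bm.
  by move: mB; rewrite mem_set.
split=> [[m [s XB]]|[m [s [s0 XB]]]]; exists m.
  exists `|s|; split=> // B mB; rewrite XB//.
  have [->|s0] := eqVneq s 0; first by rewrite normr0 aff0.
  transitivity (normal_prob m `|s| B).
    by have [_|_] := ger0P s; rewrite ?normal_probN.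
  by apply: normal_prob_affine => //; rewrite normr_gt0.
exists s => B mB; rewrite XB//; have [->|sN0] := eqVneq s 0; first by rewrite aff0.
by apply/esym/normal_prob_affine => //; rewrite lt_def sN0.
Qed.

Let idR : measurableTypeR R -> R := idfun.

(** Inverts the affine map. It yields the finite second moment of N(0,1) from any square integrable
    variable with a nondegenerate normal law. *)
Lemma affine_L2_id (m s : R) : s != 0 -> (affine m s : measurableTypeR R -> R) \in Lfun g 2%:E ->
  idR \in Lfun g 2%:E.
Proof.
move=> s0 aL.
have -> : idR = s^-1 *: (affine m s - cst m).
  by apply/funext => x; rewrite /= -[RHS]/(s^-1 * (m + s * x - m)) addrAC subrr add0r mulKf.
by rewrite rpredZ// rpredB// cst_L2.
Qed.

Section moments.
Hypothesis idL : idR \in Lfun g 2%:E.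
Let b := ip g idR (cst 1).
Let v := ip g idR idR - b ^+ 2.

Lemma affineE (m s : R) : affine m s = cst m + s *: idR.
Proof. by []. Qed.

Lemma normal_expectation (m s : R) : ip g (affine m s) (cst 1) = m + s * b.
Proof.
have c1 := cst_L2 g 1; have cm := cst_L2 g m.
rewrite affineE ipDl ?ipZl ?rpredZ//; congr (_ + _).
by rewrite ip_cst1 expectation_cst.
Qed.

Lemma normal_variance (m s : R) :
  ip g (affine m s) (affine m s) - ip g (affine m s) (cst 1) ^+ 2 = s ^+ 2 * v.
Proof.
have c1 := cst_L2 g 1; have cm := cst_L2 g m.
have cE f : f \in Lfun g 2%:E -> ip g (cst m) f = m * ip g f (cst 1).
  move=> fL; rewrite [RHS]mulrC -[in LHS](mulr1 m) -[cst _]/(m *: cst 1 : R -> R).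
  by rewrite ipZl// ipC mulrC.
rewrite normal_expectation /v {1 2}affineE ipDl ?rpredD ?rpredZ// ipDr ?rpredZ//.
rewrite ipDr ?rpredZ// !ipZl ?rpredZ// !ipZr//.
rewrite (ipC _ idR (cst m)) !cE// -/b (ip_cst1 _ (cst 1)) expectation_cst /=.
by ring.
Qed.

(** v is the squared norm of x - b. Were it 0, N(0,1) would be concentrated at b, but it is
    dominated by Lebesgue measure, for which {b} is null. *)
Lemma normal_variance_gt0 : 0 < v.
Proof.
have c1 := cst_L2 g 1; have cb := cst_L2 g b.
have bL : idR - cst b \in Lfun g 2%:E by rewrite rpredB.
have -> : v = nrm g (idR - cst b) ^+ 2.
  (* The map x - b is [affine (- b) 1], of mean 0, so its variance is its squared norm. *)
  rewrite nrm_sqr//; have := normal_variance (- b) 1.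
  rewrite normal_expectation expr1n !mul1r addNr expr0n /= subr0 => <-.
  by congr (ip g _ _); rewrite affineE scale1r addrC.
rewrite exprn_even_gt0//=; apply/eqP => n0.
have : (EFin \o (idR - cst b)) = \0%E %[ae g].
  apply: (@Lnorm_eq0_eq0 _ _ _ _ _ 2%:E) => //.
    by apply/measurable_EFinP; exact: (L2_measurable bL).
  by rewrite nrm_fin// n0.
have b0 : g [set b] = 0%E.
  have /null_content_dominatesP := normal_prob_dominates (0 : R) 1.
  apply; first exact: measurable_set1.
  exact: lebesgue_measure_set1.
move=> [N [mN N0 sN]].
(* The line is covered by the null sets N and {b}, so its probability 1 would be at most 0. *)
have : (g setT <= g (N `|` [set b]))%E.
  apply: le_measure; rewrite ?inE//; first exact: measurableU.
  move=> x _; have [->|xb] := eqVneq x b; first by right.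
  left; apply: sN => /= h.
  have : (x - b)%:E = 0%:E :> \bar R by exact: (h I).
  by case=> xb0; move: xb; rewrite -subr_eq0 xb0 eqxx.
rewrite probability_setT measureU0//.
by rewrite [X in (_ <= X)%E]N0 lee_fin ler10.
Qed.
End moments.
End normal_law.

(** * L2 limits of normal variables *)

(** For k > 0: 0 up to a - 1/k, 1 from a on, linear between; a k-Lipschitz majorant of the indicator
    of [a, +oo[. *)
Definition ramp {R : realType} (k : nat) (a y : R) : R :=
  Num.min 1 (Num.max 0 (1 + k%:R * (y - a))).

Lemma ramp_ge0 {R : realType} k (a y : R) : 0 <= ramp k a y.
Proof. by rewrite /ramp le_min ler01 le_max lexx. Qed.

Lemma ramp_le1 {R : realType} k (a y : R) : ramp k a y <= 1.
Proof. by rewrite /ramp ge_min lexx. Qed.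

(** The affine function has slope k, and clipping to [0, 1] does not increase distances; the latter
    is the case analysis on u and w. *)
Lemma ramp_lipschitz {R : realType} k (a x y : R) :
  `|ramp k a x - ramp k a y| <= k%:R * `|x - y|.
Proof.
rewrite -[k%:R]ger0_norm// -normrM.
have -> : k%:R * (x - y) = (1 + k%:R * (x - a)) - (1 + k%:R * (y - a)) by ring.
rewrite /ramp; move: (1 + _) (1 + _) => u w.
have := ler_norm (u - w); have := ler_norm (w - u); rewrite distrC.
move: `|u - w| => z wz uz; rewrite ler_norml.
have [?|?] := leP 0 u; have [?|?] := leP 0 w; have [?|?] := leP 1 u;
  have [?|?] := leP 1 w; rewrite ?(min_r ler01); apply/andP; split; lra.
Qed.

Lemma measurable_ramp {R : realType} k (a : R) : measurable_fun setT (ramp k a).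
Proof.
apply: measurable_minr => //; apply: measurable_maxr => //.
by apply: measurable_funD => //; apply: measurable_funM => //; exact: measurable_funB.
Qed.

Lemma ramp_cvg {R : realType} (a y : R) :
  ramp k a y @[k --> \oo] --> (\1_`[a, +oo[ y : R).
Proof.
apply: cvg_near_cst; rewrite indicE mem_setE in_itv/= andbT.
have [ay|ya] := leP a y.
  apply: nearW => k; rewrite /ramp max_r ?min_l//; last first.
    by rewrite addr_ge0// mulr_ge0// subr_ge0.
  by rewrite lerDl mulr_ge0 ?subr_ge0.
(* From k >= 1 / (a - y) on, 1 + k (y - a) <= 0 and the ramp vanishes at y. *)
exists (Num.truncn (a - y)^-1).+1 => // k /= hk.
have : (a - y)^-1 <= k%:R.
  by apply: ltW; apply: lt_le_trans (truncnS_gt _) _; rewrite ler_nat.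
rewrite -[X in X <= _]mul1r ler_pdivrMr ?subr_gt0// => h.
by rewrite /ramp max_l ?min_r//; nra.
Qed.

(** * Expectations of ramps *)

Section ramp_law.
Context {R : realType} {d : measure_display} {T : measurableType d}.
Variable P : probability T R.

Lemma nrm_le (f h : T -> R) : f \in Lfun P 2%:E -> h \in Lfun P 2%:E ->
  (forall x, `|f x| <= `|h x|) -> nrm P f <= nrm P h.
Proof.
move=> fL hL fh; rewrite -(@ler_pXn2r _ 2) ?nnegrE ?nrm_ge0//.
rewrite !nrm_sqr// -lee_fin -!ip_fin//.
have mf := L2_measurable fL; have mh := L2_measurable hL.
apply: expectation_le => /=; [exact: measurable_funM|exact: measurable_funM| | |].
- by move=> x; rewrite -expr2 sqr_ge0.
- by move=> x; rewrite -expr2 sqr_ge0.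
- by apply: nearW => x; rewrite -!expr2 -(real_normK (num_real (f x)))
    -(real_normK (num_real (h x))) ler_pXn2r ?nnegrE.
Qed.

Lemma ramp_L2 k a (X : T -> R) : measurable_fun setT X ->
  ramp k a \o X \in Lfun P 2%:E.
Proof.
move=> mX; have mr : measurable_fun setT (ramp k a \o X).
  by apply: measurableT_comp => //; exact: measurable_ramp.
apply/integrable_L2; split => //.
apply: (@le_integrable _ _ _ P setT measurableT _ (cst 1%:E)) => //;
  last exact: finite_measure_integrable_cst.
  by apply/measurable_EFinP; exact: measurable_funX.
move=> x _; rewrite /= lee_fin normr1 ger0_norm ?sqr_ge0// expr_le1 ?ramp_ge0//.
exact: ramp_le1.
Qed.

(** For fixed k, composing with the ramp multiplies L^2 distances by at most k; pairing with the
    constant 1 gives expectations. *)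
Lemma ramp_cvg_nrm k a (X_ : nat -> T -> R) (X : T -> R) :
  (forall n, X_ n \in Lfun P 2%:E) -> X \in Lfun P 2%:E ->
  nrm P (X_ n - X) @[n --> \oo] --> 0 ->
  ip P (ramp k a \o X_ n) (cst 1) @[n --> \oo] --> ip P (ramp k a \o X) (cst 1).
Proof.
move=> XnL XL c.
have rnL n := ramp_L2 k a (L2_measurable (XnL n)).
have rL := ramp_L2 k a (L2_measurable XL).
apply: ip_cvgl => //; first exact: cst_L2.
apply: (@cvg_dist_le _ _ (fun n => k%:R * nrm P (X_ n - X))).
  move=> n; rewrite subr0 ger0_norm ?nrm_ge0// -[k%:R]ger0_norm// -nrmZ ?rpredB//.
  apply: nrm_le; [by rewrite rpredB|by rewrite rpredZ// rpredB|].
  move=> x; rewrite -[(_ *: _) x]/(k%:R * (X_ n x - X x)).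
  by rewrite normrM (ger0_norm (ler0n _ _)); exact: ramp_lipschitz.
by rewrite -[X in _ --> X](mulr0 k%:R); apply: cvgM => //; exact: cvg_cst.
Qed.

(** Dominated convergence with the bound 1: as k grows, the ramps recover the probability that X >=
    a. *)
Lemma ramp_cvg_law (X : {RV P >-> R}) a :
  (ip P (ramp k a \o X) (cst 1))%:E @[k --> \oo] --> distribution P X `[a, +oo[%classic.
Proof.
have -> : distribution P X `[a, +oo[%classic = (\int[P]_x (\1_(X @^-1` `[a, +oo[) x)%:E)%E.
  by rewrite integral_indic ?setIT//; apply: measurable_funPTI.
have mr k : measurable_fun setT (ramp k a \o X).
  by apply: measurableT_comp => //; exact: measurable_ramp.
have mi : measurable_fun setT (\1_(X @^-1` `[a, +oo[) : T -> R).
  by apply: measurable_indic; apply: measurable_funPTI.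
have [] := @dominated_convergence _ _ _ P setT measurableT
  (fun k x => (ramp k a (X x))%:E) (fun x => (\1_(X @^-1` `[a, +oo[) x)%:E) (cst 1%:E).
- by move=> k; apply/measurable_EFinP; exact: mr.
- exact/measurable_EFinP.
- apply: nearW => x _; apply: cvg_EFin; first exact: nearW.
  rewrite (_ : \1_(X @^-1` `[a, +oo[) x = \1_`[a, +oo[ (X x))//.
  exact: ramp_cvg.
- exact: finite_measure_integrable_cst.
- apply: nearW => x k _; rewrite /= lee_fin ger0_norm ?ramp_ge0//; exact: ramp_le1.
move=> _ _; apply: cvg_trans; apply: near_eq_cvg; apply: nearW => k /=.
have rL := ramp_L2 k a (measurable_funPT X).
rewrite ip_cst1 fineK ?expectation_fin_num ?L2_Lfun1//.
by rewrite unlock.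
Qed.
End ramp_law.

Section normal_limit.
Context {R : realType} {d : measure_display} {T : measurableType d}.
Variable P : probability T R.
Let g : probability (measurableTypeR R) R := normal_prob (0 : R) 1.

(** Two limits in turn: for fixed k the expectations of the ramps agree for every n, hence for the
    L^2 limits; then k tends to infinity. *)
Lemma eq_law_limit (X_ : nat -> {RV P >-> R}) (X : {RV P >-> R})
    (m_ s_ : nat -> R) (m s : R) :
  (forall n, (X_ n : T -> R) \in Lfun P 2%:E) -> (X : T -> R) \in Lfun P 2%:E ->
  nrm P ((X_ n : T -> R) - X) @[n --> \oo] --> 0 ->
  (forall n, eq_law (X_ n) (affine (m_ n) (s_ n) : {RV g >-> R})) ->
  (affine m s : measurableTypeR R -> R) \in Lfun g 2%:E ->
  nrm g ((affine (m_ n) (s_ n) : measurableTypeR R -> R) - affine m s)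
    @[n --> \oo] --> 0 ->
  eq_law X (affine m s : {RV g >-> R}).
Proof.
move=> XnL XL Xc Xlaw aL ac; apply: eq_law_itvcy => a.
have h1 := @ramp_cvg_law _ _ _ P X a.
have h2 := @ramp_cvg_law _ _ _ g (affine m s) a.
suff E k : ip P (ramp k a \o X) (cst 1) =
    ip g (ramp k a \o (affine m s : {RV g >-> R})) (cst 1).
  by move: h1; under eq_fun do rewrite E; move=> h1; exact: (cvg_unique _ h1 h2).
have c1 := @ramp_cvg_nrm _ _ _ P k a _ _ XnL XL Xc.
have anL n := eq_law_L2 (Xlaw n) (XnL n).
have c2 := @ramp_cvg_nrm _ _ _ g k a _ _ anL aL ac.
suff E n : ip P (ramp k a \o X_ n) (cst 1) =
    ip g (ramp k a \o (affine (m_ n) (s_ n) : {RV g >-> R})) (cst 1).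
  by move: c1; under eq_fun do rewrite E; move=> c1; exact: (cvg_unique _ c1 c2).
rewrite !ip_cst1 unlock; congr fine.
apply: (eq_law_ge0_integral (Xlaw n) (f := fun y => (ramp k a y)%:E)).
  by apply/measurable_EFinP; exact: measurable_ramp.
by move=> y; rewrite lee_fin ramp_ge0.
Qed.

Lemma normal_law_limit (X_ : nat -> {RV P >-> R}) (X : {RV P >-> R}) :
  (forall n, (X_ n : T -> R) \in Lfun P 2%:E) -> (X : T -> R) \in Lfun P 2%:E ->
  nrm P ((X_ n : T -> R) - X) @[n --> \oo] --> 0 ->
  (forall n, normal_law (X_ n)) -> normal_law X.
Proof.
move=> XnL XL Xc XN.
have /choice[ms msP] n : exists ms : R * R, 0 <= ms.2 /\
    eq_law (X_ n) (affine ms.1 ms.2 : {RV g >-> R}).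
  by have /normal_lawP[m [s ?]] := XN n; exists (m, s).
pose m_ n := (ms n).1; pose s_ n := (ms n).2.
have s_ge0 n : 0 <= s_ n by case: (msP n).
have law n : eq_law (X_ n) (affine (m_ n) (s_ n) : {RV g >-> R}) by case: (msP n).
have anL n : (affine (m_ n) (s_ n) : measurableTypeR R -> R) \in Lfun g 2%:E.
  exact: eq_law_L2 (law n) (XnL n).
have Ecvg : ip P (X_ n) (cst 1) @[n --> \oo] --> ip P X (cst 1).
  by apply: ip_cvgl => //; exact: cst_L2.
have Qcvg : ip P (X_ n) (X_ n) @[n --> \oo] --> ip P X X by exact: ip_cvg.
have Eeq n : ip P (X_ n) (cst 1) = ip g (affine (m_ n) (s_ n)) (cst 1).
  by rewrite !ip_cst1 (eq_law_expectation (law n)).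
have Qeq n : ip P (X_ n) (X_ n) = ip g (affine (m_ n) (s_ n)) (affine (m_ n) (s_ n)).
  exact: eq_law_ip (law n).
pose idR : measurableTypeR R -> R := idfun.
have dist0 (u : nat -> R) l : u n @[n --> \oo] --> l ->
    `|u n - l| @[n --> \oo] --> 0.
  by move=> /subr_cvg0/cvg_norm; rewrite normr0.
(* The second moment of N(0,1) is finite because that of X_N is, as soon as
   s_N != 0; if there is no such N then every X_n is almost surely constant. *)
have [[N sN]|/forallNP s0] := pselect (exists n, s_ n != 0).
  have idL : idR \in Lfun g 2%:E := affine_L2_id sN (anL N).
  set b := ip g idR (cst 1); set v := ip g idR idR - b ^+ 2.
  have v0 : 0 < v := normal_variance_gt0 idL.
  (* As s_n >= 0 and v > 0, s_n is a continuous function of the first two moments of X_n, which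
     converge. *)
  have s2 n : s_ n = Num.sqrt ((ip P (X_ n) (X_ n) - ip P (X_ n) (cst 1) ^+ 2) / v).
    rewrite Eeq Qeq (normal_variance idL (m_ n)) mulfK ?gt_eqF//.
    by rewrite sqrtr_sqr ger0_norm.
  pose s := Num.sqrt ((ip P X X - ip P X (cst 1) ^+ 2) / v).
  have sc : s_ n @[n --> \oo] --> s.
    under eq_fun do rewrite s2.
    apply: continuous_cvg; first exact: sqrt_continuous.
    apply: cvgM; last exact: cvg_cst.
    by apply: cvgB => //; rewrite expr2; under eq_fun do rewrite expr2; exact: cvgM.
  pose m := ip P X (cst 1) - s * b.
  have mc : m_ n @[n --> \oo] --> m.
    have E n : m_ n = ip P (X_ n) (cst 1) - s_ n * b.
      by rewrite Eeq (normal_expectation idL) addrK.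
    under eq_fun do rewrite E.
    by apply: cvgB => //; apply: cvgM => //; exact: cvg_cst.
  apply/normal_lawP; exists m, s; split; first exact: sqrtr_ge0.
  have cL c := cst_L2 g c.
  apply: eq_law_limit XnL XL Xc law _ _.
    by rewrite affineE rpredD// rpredZ.
  (* Triangle inequality for (m_n - m) 1 + (s_n - s) id, the constant 1 having norm 1. *)
  apply: (@cvg_dist_le _ _ (fun n => `|m_ n - m| + `|s_ n - s| * nrm g idR)).
    move=> n; rewrite subr0 ger0_norm ?nrm_ge0//.
    have -> : (affine (m_ n) (s_ n) : measurableTypeR R -> R) - affine m s =
        (m_ n - m) *: cst 1 + (s_ n - s) *: idR.
      apply/funext => x; rewrite -[LHS]/(m_ n + s_ n * x - (m + s * x)).
      by rewrite -[RHS]/((m_ n - m) * 1 + (s_ n - s) * x); ring.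
    apply: le_trans (nrmD _ _) _; rewrite ?rpredZ//.
    by rewrite !nrmZ// nrm_cst1 mulr1.
  rewrite -[X in _ --> X](addr0 0) -[X in _ --> _ + X](mul0r (nrm g idR)).
  by apply: cvgD; [|apply: cvgM; last exact: cvg_cst]; exact: dist0.
(* Now each X_n has a Dirac law at m_n = E[X_n], and the limit law is the Dirac mass at E[X]. *)
have {}s0 n : s_ n = 0 by apply/eqP/negPn/negP; exact: s0.
have affE m : (affine m 0 : measurableTypeR R -> R) = cst m.
  by apply/funext => x; rewrite /affine mul0r addr0.
pose m := ip P X (cst 1).
have mE n : m_ n = ip P (X_ n) (cst 1).
  by rewrite Eeq s0 affE ip_cst1 expectation_cst.
apply/normal_lawP; exists m, 0; split=> //.
apply: eq_law_limit XnL XL Xc law _ _; first by rewrite affE cst_L2.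
apply: (@cvg_dist_le _ _ (fun n => `|m_ n - m|)).
  move=> n; rewrite subr0 ger0_norm ?nrm_ge0// s0 !affE.
  have -> : cst (m_ n) - cst m = (m_ n - m) *: cst 1 :> (measurableTypeR R -> R).
    by apply/funext => x; rewrite -[RHS]/((m_ n - m) * 1) mulr1.
  by rewrite nrmZ ?cst_L2// nrm_cst1 mulr1.
under eq_fun do rewrite mE.
exact: dist0.
Qed.
End normal_limit.

(** * Absolutely convergent series in L2 *)

Section L2_series.
Context {R : realType} {d : measure_display} {T : measurableType d}.
Variables (P : probability T R) (X : nat -> T -> R) (u : nat -> R).
Hypothesis XL : forall t, X t \in Lfun P 2%:E.
Hypothesis Xu : forall t, nrm P (X t) <= u t.
Hypothesis cu : cvgn (series u).

Let S n : T -> R := \sum_(0 <= t < n) X t.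

Let SL n : S n \in Lfun P 2%:E.
Proof. by rewrite /S rpred_sum. Qed.

Let SE n x : S n x = series (X ^~ x) n.
Proof. by rewrite /S /series /=; elim/big_ind2 : _ => // f a h b <- <-. Qed.

Let u_ge0 t : 0 <= u t.
Proof. exact: le_trans (nrm_ge0 _ _) (Xu t). Qed.

Let series_le n : series u n <= limn (series u).
Proof. by apply: nondecreasing_cvgn_le => //; exact/nondecreasing_series. Qed.

(** Cauchy-Schwarz against the constant 1. *)
Let expectation_normr t : (\int[P]_x `|X t x|%:E <= (u t)%:E)%E.
Proof.
have aL : Num.norm \o X t \in Lfun P 2%:E.
  apply/integrable_L2; split.
    by apply: measurableT_comp => //; exact: L2_measurable (XL t).
  by under eq_fun do rewrite /= real_normK ?num_real//; exact: Lfun2_integrable_sqr.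
have -> : (\int[P]_x `|X t x|%:E = (ip P (Num.norm \o X t) (cst 1))%:E)%E.
  by rewrite ip_cst1 fineK ?expectation_fin_num ?L2_Lfun1// unlock.
rewrite lee_fin (le_trans (ler_norm _))// (le_trans (ip_CS _ _)) ?cst_L2//.
rewrite nrm_cst1 mulr1 (le_trans _ (Xu t))//.
by apply: nrm_le => // x; rewrite /= normr_id.
Qed.

Let mX t : measurable_fun setT (X t). Proof. exact: L2_measurable (XL t). Qed.

(** The sum H of the |X_t| has integral at most the sum of the u_t, so H is finite almost
    everywhere, and absolute convergence follows. *)
Lemma L2_series_ae_cvg : {ae P, forall x, cvgn (series (X ^~ x))}.
Proof.
pose H x := (\sum_(t <oo) `|X t x|%:E)%E.
have mH : measurable_fun setT H.
  apply: ge0_emeasurable_sum => //.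
  by move=> t _; apply/measurable_EFinP; exact: measurableT_comp.
have iH : P.-integrable setT H.
  apply/integrableP; split => //.
  under eq_integral do rewrite gee0_abs ?nneseries_ge0//.
  rewrite integral_nneseries//; last first.
    by move=> t; apply/measurable_EFinP; exact: measurableT_comp.
  apply: (@le_lt_trans _ _ (limn (series u))%:E); last exact: ltry.
  apply: lime_le.
    by apply: is_cvg_nneseries => t _ _; apply: integral_ge0.
  apply: nearW => n; rewrite (le_trans _ (_ : (series u n)%:E <= _)%E) ?lee_fin//.
  by rewrite /series /= -sumEFin; apply: lee_sum => t _.
have := integrable_ae measurableT iH; apply: filterS => x /(_ I) Hx.
apply: (@normed_cvg _ R^o); apply: nondecreasing_is_cvgn.
  by apply: nondecreasing_series => t *; exact: normr_ge0.
exists (fine (H x)) => _ [n _ <-]; rewrite -lee_fin fineK// /series /= -sumEFin.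
exact: nneseries_lim_ge.
Qed.

(** An upper limit is measurable and defined at every point, even where the series diverges; [fine]
    makes it real-valued. *)
Definition L2_series_lim (x : T) : R := fine (limn_esup (fun n => (S n x)%:E)).

Lemma measurable_L2_series_lim : measurable_fun setT L2_series_lim.
Proof.
apply: measurableT_comp; first exact: fine_measurable.
apply: measurable_fun_limn_esup => n.
by apply/measurable_EFinP; exact: L2_measurable (SL n).
Qed.

Lemma L2_series_ae_lim : {ae P, forall x, S n x @[n --> \oo] --> L2_series_lim x}.
Proof.
apply: filterS L2_series_ae_cvg => x /cvg_ex[l cl].
have cS : S n x @[n --> \oo] --> l by under eq_fun do rewrite SE.
have cE : (S n x)%:E @[n --> \oo] --> l%:E by apply: cvg_EFin => //; exact: nearW.
by rewrite /L2_series_lim (cvg_limn_einf_sup cE).2.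
Qed.

(** For fixed n, the squared distance from S_n to S_(n+m) is at most w^2, w being the tail of the
    series of u. Fatou's lemma in m carries this bound to the pointwise limit. *)
Lemma L2_series_tail n : S n - L2_series_lim \in Lfun P 2%:E /\
  nrm P (S n - L2_series_lim) <= limn (series u) - series u n.
Proof.
set w := limn _ - _.
have w0 : 0 <= w by rewrite subr_ge0.
have Sm m : nrm P (S n - S (n + m)) <= w.
  have -> : S n - S (n + m) = - 1 *: \sum_(n <= t < n + m) X t.
    by rewrite /S [X in _ - X](@big_cat_nat _ _ _ n) ?leq_addr//= opprD addrA subrr add0r scaleN1r.
  rewrite nrmZ ?rpred_sum// normrN1 mul1r (le_trans (nrm_sum _ _))//.
  apply: (@le_trans _ _ (\sum_(n <= t < n + m) u t)); first exact: ler_sum.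
  rewrite lerBrDl; apply: le_trans (series_le (n + m)).
  by rewrite /series /= [leRHS](@big_cat_nat _ _ _ n) ?leq_addr.
pose D m x := (((S n x - S (n + m) x) ^+ 2)%:E : \bar R).
have mS m : measurable_fun setT (S m) by exact: L2_measurable (SL m).
have mD m : measurable_fun setT (D m).
  by apply/measurable_EFinP; apply: measurable_funX; exact: measurable_funB.
have D0 m x : (0 <= D m x)%E by rewrite lee_fin sqr_ge0.
have mSY : measurable_fun setT (S n - L2_series_lim).
  by apply: measurable_funB => //; exact: measurable_L2_series_lim.
have ID m : (\int[P]_x D m x <= (w ^+ 2)%:E)%E.
  have dL : S n - S (n + m) \in Lfun P 2%:E by rewrite rpredB.
  have -> : (\int[P]_x D m x = (nrm P (S n - S (n + m)) ^+ 2)%:E)%E.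
    rewrite nrm_sqr// -ip_fin// unlock; apply: eq_integral => x _.
    by rewrite /D expr2.
  by rewrite lee_fin ler_pXn2r ?nnegrE ?nrm_ge0.
have key : (\int[P]_x (((S n x - L2_series_lim x) ^+ 2)%:E) <= (w ^+ 2)%:E)%E.
  apply: (@le_trans _ _ (\int[P]_x limn_einf (D ^~ x))%E); last first.
    apply: le_trans (fatou P measurableT mD (fun m x _ => D0 m x)) _.
    rewrite limn_einf_lim; apply: lime_le; first exact: is_cvg_einfs.
    apply: nearW => m; apply: le_trans (ID m); apply: ereal_inf_lbound.
    by exists m => //=.
  rewrite (@ae_eq_integral _ _ _ P setT (fun x => limn_einf (D ^~ x)))//.
  - by apply/measurable_EFinP; exact: measurable_funX.
  - apply: measurableT_comp => //; apply: measurable_fun_limn_esup => m.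
    by apply: measurableT_comp.
  (* Wherever the series converges, the lower limit of [D m x] in m is a limit, namely the squared
     distance to [L2_series_lim x]. *)
  - apply: filterS L2_series_ae_lim => x Sx _.
    apply/esym; apply: (cvg_limn_einf_sup _).1.
    apply: cvg_EFin; first exact: nearW.
    have c : S n x - S (n + m) x @[m --> \oo] --> S n x - L2_series_lim x.
      apply: cvgB; first exact: cvg_cst.
      exact: (cvg_comp (addn n) (fun m => S m x) (cvg_addnl n) Sx).
    have /cvg_trans : (S n x - S (n + m) x) ^+ 2 @[m --> \oo] --> (S n x - L2_series_lim x) ^+ 2.
      by under eq_fun do rewrite expr2; rewrite expr2; exact: cvgM.
    exact.
have dL : S n - L2_series_lim \in Lfun P 2%:E.
  apply/integrable_L2; split => //; apply/integrableP; split.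
    by apply/measurable_EFinP; exact: measurable_funX.
  apply: le_lt_trans (ltry (w ^+ 2)); apply: le_trans key.
  by under eq_integral do rewrite /= ger0_norm ?sqr_ge0//.
split=> //; rewrite -(@ler_pXn2r _ 2) ?nnegrE ?nrm_ge0//.
rewrite nrm_sqr// -lee_fin -ip_fin// unlock; apply: le_trans key.
by rewrite le_eqVlt; apply/orP; left; apply/eqP; apply: eq_integral => x _; rewrite expr2.
Qed.

Lemma L2_series_cvg : L2_series_lim \in Lfun P 2%:E /\
  nrm P (S n - L2_series_lim) @[n --> \oo] --> 0.
Proof.
split.
  (* The limit is S_0 - (S_0 - limit), both terms being in L^2. *)
  rewrite -[L2_series_lim](subKr (S 0)) rpredB//; exact: (L2_series_tail 0).1.
apply: (@cvg_dist_le _ _ (fun n => limn (series u) - series u n)).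
  by move=> n; rewrite subr0 ger0_norm ?nrm_ge0//; exact: (L2_series_tail n).2.
by rewrite -[X in _ --> X](subrr (limn (series u))); apply: cvgB => //; exact: cvg_cst.
Qed.
End L2_series.

(** * Summation over pairs of times *)

Section exhaustion.
Context {R : realType} {K : choiceType}.
Variable r : nat -> seq K.
Hypothesis r_uniq : forall n, uniq (r n).
Hypothesis r_mono : forall m n, (m <= n)%N -> {subset r m <= r n}.
Hypothesis r_exh : forall k, exists n, k \in r n.

(** [esum] is a supremum over finite sets, and each finite set lies in some [r N], so the increasing
    sums over [r n] have the same supremum. *)
Lemma esum_exhaustion_cvg (f : K -> \bar R) : (forall k, 0 <= f k)%E ->
  (\sum_(k <- r n) f k)%E @[n --> \oo] --> (\esum_(k in setT) f k)%E.
Proof.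
move=> f0.
have finr n : finite_set [set` r n] by apply/finite_seqP; exists (r n).
have mono m n : (m <= n)%N -> (\sum_(k <- r m) f k <= \sum_(k <- r n) f k)%E.
  move=> mn; rewrite (fsbig_seq _ _ (r_uniq m)) (fsbig_seq _ _ (r_uniq n)).
  apply: lee_fsum_nneg_subset => //.
  by move=> k; rewrite !inE /=; exact: r_mono.
pose S n := (\sum_(k <- r n) f k)%E.
suff -> : (\esum_(k in setT) f k)%E = ereal_sup (range S).
  exact: ereal_nondecreasing_cvgn.
apply/eqP; rewrite eq_le; apply/andP; split.
  apply: ge_ereal_sup => _ [A [/finite_seqP[s ->] _] <-].
  have [N sN] : exists N, {subset s <= r N}.
    elim: s => [|k s [N sN]]; first by exists 0%N.
    have [M kM] := r_exh k; exists (maxn M N) => x; rewrite inE.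
    move=> /predU1P[->|xs]; first exact: r_mono (leq_maxl _ _) _ kM.
    exact: r_mono (leq_maxr _ _) _ (sN _ xs).
  apply: (@le_trans _ _ (S N)); last by apply: ereal_sup_ubound; exists N.
  rewrite /S (fsbig_seq _ _ (r_uniq N)); apply: lee_fsum_nneg_subset => //.
  by move=> k; rewrite !inE /=; exact: sN.
apply: ge_ereal_sup => _ [n _ <-]; apply: esum_ge; exists [set` r n] => //.
by rewrite /S (fsbig_seq _ _ (r_uniq n)).
Qed.

Lemma summable_exhaustion (f : K -> R) (M : R) :
  (forall n, \sum_(k <- r n) `|f k| <= M) ->
  summable [set: K] (fun k => (f k)%:E).
Proof.
move=> fM; rewrite /summable; apply: (@le_lt_trans _ _ M%:E); last exact: ltry.
have c := @esum_exhaustion_cvg (fun k => `|(f k)%:E|)%E (fun k => abse_ge0 _).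
rewrite -(cvg_lim _ c)//; apply: lime_le; first by apply/cvg_ex; eexists; exact: c.
by apply: nearW => n; rewrite sumEFin lee_fin.
Qed.

(** Summability makes the sums of the positive and negative parts finite; each part converges by
    exhaustion and the limits can be subtracted. *)
Lemma fine_esum_exhaustion_cvg (f : K -> R) :
  summable [set: K] (fun k => (f k)%:E) ->
  \sum_(k <- r n) f k @[n --> \oo] -->
  fine (esum [set: K] (EFin \o f)^\+ - esum [set: K] (EFin \o f)^\-)%E.
Proof.
move=> fs.
have pfin : esum [set: K] (EFin \o f)^\+%E \is a fin_num.
  have := summable_funepos fs; rewrite summableE.
  by under eq_esum do rewrite gee0_abs//.
have nfin : esum [set: K] (EFin \o f)^\-%E \is a fin_num.
  have := summable_funeneg fs; rewrite summableE.
  by under eq_esum do rewrite gee0_abs//.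
apply: (@fine_cvg _ _ _ _ (fun n => (\sum_(k <- r n) f k)%:E)).
rewrite fineK; last by rewrite fin_numB pfin.
have cp := @esum_exhaustion_cvg (EFin \o f)^\+%E (funepos_ge0 _).
have cn := @esum_exhaustion_cvg (EFin \o f)^\-%E (funeneg_ge0 _).
have := cvgeB _ cp cn; rewrite fin_num_adde_defl ?fin_numN// => /(_ _ isT).
apply: cvg_trans; apply: near_eq_cvg; apply: nearW => n /=.
have -> : (\sum_(k <- r n) (EFin \o f)^\+ k = (\sum_(k <- r n) Num.max (f k) 0)%:E)%E.
  by rewrite -sumEFin; apply: eq_bigr => k _; rewrite funeposE EFin_max.
have -> : (\sum_(k <- r n) (EFin \o f)^\- k = (\sum_(k <- r n) Num.max (- f k) 0)%:E)%E.
  by rewrite -sumEFin; apply: eq_bigr => k _; rewrite funenegE EFin_max.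
rewrite -EFinB -sumrB; congr EFin; apply: eq_bigr => k _.
by have [?|?] := leP 0 (f k); have [?|?] := leP 0 (- f k); lra.
Qed.
End exhaustion.

(** * Exhausting the times of one or two episodes *)

Section times.
Context {Z : Type}.

(* Constant in N when the episode is finite, so that finite and infinite
   episodes are both handled by letting N tend to infinity. *)
Definition times (e : episode Z) (N : nat) : seq (time e) :=
  match e return seq (time e) with
  | Defs.Finite s => index_enum 'I_(size s)
  | Infinite _ => index_iota 0 N
  end.

Lemma times_uniq e N : uniq (times e N).
Proof. by case: e => [s|z] /=; [exact: index_enum_uniq|exact: iota_uniq]. Qed.

Lemma times_mono e m n : (m <= n)%N -> {subset times e m <= times e n}.
Proof.
case: e => [s|z] mn t; first by [].
have tE p : (t \in times (Infinite z) p) = (t < p)%N by exact: mem_index_iota.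
by rewrite !tE => /leq_trans; apply.
Qed.

Lemma times_exh e (t : time e) : exists N, t \in times e N.
Proof.
case: e t => [s|z] t /=; first by exists 0%N; rewrite mem_index_enum.
by exists t.+1; have := mem_index_iota 0 t.+1 t; rewrite /= ltnSn => ->.
Qed.

(** Square truncation, matching the product of two N-th partial sums. *)
Definition times2 (e e' : episode Z) N : seq (time e * time e') :=
  [seq (t, u) | t <- times e N, u <- times e' N].

Lemma times2_uniq e e' N : uniq (times2 e e' N).
Proof. by apply: allpairs_uniq; rewrite ?times_uniq// => -[? ?] [? ?]. Qed.

Lemma times2_mono e e' m n : (m <= n)%N -> {subset times2 e e' m <= times2 e e' n}.
Proof.
move=> mn _ /allpairsP[[t u] /= [tm um ->]].
by apply/allpairsP; exists (t, u); split=> //=; exact: times_mono mn _ _.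
Qed.

Lemma times2_exh e e' (tu : time e * time e') : exists N, tu \in times2 e e' N.
Proof.
case: tu => t u; have [m tm] := times_exh t; have [n un] := times_exh u.
exists (maxn m n); apply/allpairsP; exists (t, u); split=> //=.
- exact: times_mono (leq_maxl _ _) _ tm.
- exact: times_mono (leq_maxr _ _) _ un.
Qed.

Context {R : realType}.
Variable gamma : R.
Hypotheses (gamma_ge0 : 0 <= gamma) (gamma_lt1 : gamma < 1).

(** For both kinds of episode this is a partial sum of the geometric series. *)
Lemma sum_times_le e N :
  \sum_(t <- times e N) gamma ^+ time_val t <= (1 - gamma)^-1.
Proof.
have geo n : \sum_(0 <= t < n) gamma ^+ t <= (1 - gamma)^-1.
  have c : series (geometric 1 gamma) @ \oo --> 1 * (1 - gamma)^-1.
    by apply: cvg_geometric_series; rewrite ger0_norm.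
  rewrite -[leRHS]mul1r -(cvg_lim _ c)//.
  rewrite (_ : \sum_(_ <= _ < _) _ = series (geometric 1 gamma) n); last first.
    by apply: eq_bigr => i _; rewrite /= mul1r.
  apply: nondecreasing_cvgn_le; last by apply/cvg_ex; eexists; exact: c.
  by apply: nondecreasing_series => t *; rewrite /= mul1r exprn_ge0.
case: e => [s|z] /=; last exact: geo.
by rewrite -(big_mkord xpredT (fun t => gamma ^+ t)).
Qed.

Lemma summable_discounted_term (k : Z -> Z -> R) (M : R) e e' :
  (forall z z', `|k z z'| <= M) ->
  summable [set: time e * time e'] (fun tu => (discounted_term gamma k tu)%:E).
Proof.
(* M may be negative if Z is empty, so [|M|] is used as the nonnegative bound. *)
move=> kM; have kM' z z' : `|k z z'| <= `|M|.
  by rewrite (le_trans (kM _ _))// ler_norm.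
(* The bound is [|M|] times the product of the two geometric sums. *)
apply: (@summable_exhaustion _ _ _ (times2_uniq e e') (@times2_mono e e')
  (@times2_exh e e') _ (`|M| * ((1 - gamma)^-1 * (1 - gamma)^-1))) => N.
rewrite big_allpairs_dep/=.
apply: (@le_trans _ _ (\sum_(t <- times e N) \sum_(u <- times e' N)
   (`|M| * (gamma ^+ time_val t * gamma ^+ time_val u)))).
  apply: ler_sum => t _; apply: ler_sum => u _.
  rewrite /discounted_term/= normrM ger0_norm ?exprn_ge0// exprD mulrC.
  by rewrite ler_wpM2r// mulr_ge0 ?exprn_ge0.
under eq_bigr do rewrite -mulr_sumr -mulr_sumr.
rewrite -mulr_sumr -mulr_suml ler_wpM2l// ler_pM ?sum_times_le//.
  by apply: sumr_ge0 => t _; rewrite exprn_ge0.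
by apply: sumr_ge0 => t _; rewrite exprn_ge0.
Qed.

Lemma discounted_kernel_cvg (k : Z -> Z -> R) e e' :
  summable [set: time e * time e'] (fun tu => (discounted_term gamma k tu)%:E) ->
  \sum_(t <- times e N) \sum_(u <- times e' N) discounted_term gamma k (t, u)
    @[N --> \oo] --> discounted_kernel gamma k e e'.
Proof.
move=> sk; have := fine_esum_exhaustion_cvg (times2_uniq e e') (@times2_mono e e')
  (@times2_exh e e') sk.
by under eq_fun do rewrite big_allpairs_dep/=.
Qed.

End times.

(** * Discounted sums of a Gaussian process *)

Section gaussian_shift.
Context {R : realType} {d : measure_display} {T : measurableType d}.
Variable P : probability T R.

Lemma mfun_sumE (I : Type) (r : seq I) (X : I -> {RV P >-> R}) :
  (\sum_(i <- r) X i : {RV P >-> R}) = \sum_(i <- r) (X i : T -> R) :> (T -> R).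
Proof. by elim/big_ind2 : _ => // f a h b <- <-. Qed.

Lemma RV_sumE (I : Type) (r : seq I) (X : I -> {RV P >-> R}) x :
  (\sum_(i <- r) X i : {RV P >-> R}) x = \sum_(i <- r) X i x.
Proof. by elim/big_ind2 : _ => // f a h b <- <-. Qed.

Lemma normal_law_shift (X Y : {RV P >-> R}) (c : R) :
  (forall x, Y x = X x + c) -> normal_law X -> normal_law Y.
Proof.
move=> YX /normal_lawP[m [s [s0 law]]]; apply/normal_lawP; exists (m + c), s.
split=> // B mB.
have mB' : measurable ((fun y : R => y + c) @^-1` B).
  by rewrite -[X in measurable X]setTI; apply: measurable_funD.
transitivity (distribution P X ((fun y : R => y + c) @^-1` B)).
  by congr (P _); apply/funext => x; rewrite /preimage /= YX.
rewrite law//; congr (normal_prob 0 1 _); apply/funext => x.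
by rewrite /preimage /= /affine addrAC.
Qed.

(** A list of pairs allows repeated indices, as in the flattened double sums met later; its
    positions provide the ordinal family. *)
Lemma gaussian_combination (I : Type) (X : I -> {RV P >-> R}) (mu : I -> R)
    (C : I -> I -> R) (s : seq (R * I)) :
  gaussian_process X mu C -> normal_law (\sum_(p <- s) p.1 *: X p.2 : {RV P >-> R}).
Proof.
move=> Xgp; rewrite big_tnth.
have [+ _ _] := Xgp (size s) (fun l => (tnth (in_tuple s) l).2).
exact.
Qed.

Variables (I : Type) (X : I -> {RV P >-> R}) (mu : I -> R) (C : I -> I -> R).
Hypothesis Xgp : gaussian_process X mu C.

Definition centered (i : I) : {RV P >-> R} := X i - (cst (mu i) : {mfun T >-> R}).

Lemma centeredE i : (centered i : T -> R) = X i \- cst (mu i).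
Proof. by []. Qed.

Lemma gaussian_mean i : ('E_P[X i] = (mu i)%:E)%E.
Proof. by have [_ + _] := Xgp (fun _ : 'I_1 => i); apply; exact: ord0. Qed.

Lemma gaussian_cov i j : covariance P (X i) (X j) = (C i j)%:E.
Proof.
(* The two-element family (i, j), evaluated at positions 0 and 1. *)
have [_ _ /(_ ord0 (lift ord0 ord0))] :=
  Xgp (fun l : 'I_2 => if l == ord0 then i else j).
by [].
Qed.

Lemma centered_mul i j : ('E_P[(centered i : T -> R) \* centered j] = (C i j)%:E)%E.
Proof.
by rewrite -gaussian_cov covariance.unlock !gaussian_mean.
Qed.

(** By [centered_mul] on the diagonal, the expectation of the square is the real number C i i, hence
    finite. *)
Lemma centered_L2 i : (centered i : T -> R) \in Lfun P 2%:E.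
Proof.
apply/integrable_L2; split; first exact: measurable_funPT.
apply/integrableP; split.
  by apply/measurable_EFinP; apply: measurable_funX; exact: measurable_funPT.
have := centered_mul i i; rewrite expectation.unlock => E.
under eq_integral do rewrite /= ger0_norm ?sqr_ge0// expr2.
by rewrite [X in (X < _)%E]E ltry.
Qed.

Lemma ip_centered i j : ip P (centered i) (centered j) = C i j.
Proof. by rewrite /ip centered_mul. Qed.

Lemma ip_centered_cst1 i : ip P (centered i) (cst 1) = 0.
Proof.
have XL : (X i : T -> R) \in Lfun P 2%:E.
  have -> : (X i : T -> R) = (centered i : T -> R) + cst (mu i).
    by apply/funext => x; rewrite -[RHS]/(X i x - mu i + mu i) subrK.
  by rewrite rpredD ?centered_L2 ?cst_L2.
rewrite ip_cst1 centeredE expectationB ?L2_Lfun1 ?cst_L2//.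
by rewrite gaussian_mean expectation_cst subee.
Qed.

Lemma nrm_centered i : nrm P (centered i) ^+ 2 = C i i.
Proof. by rewrite nrm_sqr ?centered_L2// ip_centered. Qed.

Lemma centered_combination (s : seq (R * I)) :
  normal_law (\sum_(p <- s) p.1 *: centered p.2 : {RV P >-> R}).
Proof.
apply: (@normal_law_shift (\sum_(p <- s) p.1 *: X p.2) _
  (- \sum_(p <- s) p.1 * mu p.2)); last exact: gaussian_combination Xgp.
move=> x; rewrite !RV_sumE -sumrN -big_split; apply: eq_bigr => p _.
by rewrite -[LHS]/(p.1 * (X p.2 x - mu p.2)) mulrBr.
Qed.
End gaussian_shift.

(** * Discounted partial sums and their L^2 limits *)

Section partial_sums.
Context {R : realType} {d : measure_display} {T : measurableType d}.
Variables (P : probability T R) (Z : Type) (gamma : R).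

Definition partial_sum (e : episode Z) (A : time e -> {RV P >-> R}) (N : nat) :
    {RV P >-> R} := \sum_(t <- times e N) gamma ^+ time_val t *: A t.


Lemma partial_sum_Infinite (z : nat -> Z) (A : nat -> {RV P >-> R}) N :
  @partial_sum (Infinite z) A N = \sum_(t < N) gamma ^+ t *: A t.
Proof. by rewrite /partial_sum [LHS]big_mkord. Qed.

(** Puts both kinds of episode under one convergence: for a finite one the partial sums are constant
    in N and almost everywhere equal to Y, so the distance is 0. *)
Lemma discounted_sum_cvg e (A : time e -> {RV P >-> R}) (Y : {RV P >-> R}) :
  discounted_sum gamma A Y ->
  L2norm (P := P) (partial_sum A N - Y) @[N --> \oo] --> 0%E.
Proof.
case: e A => [s|z] A; last first.
  apply: cvg_trans; apply: near_eq_cvg; apply: nearW => n.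
  by rewrite partial_sum_Infinite.
move=> YA; rewrite [X in X @ _ --> _](_ : _ = cst 0%E); first exact: cvg_cst.
apply/funext => N; rewrite /L2norm /=; set X := partial_sum A N.
have {}YA : (Y : T -> R) = (X : T -> R) %[ae P] by [].
pose D : T -> R := (X : T -> R) - Y.
have mD : measurable_fun setT D by apply: measurable_funB; exact: measurable_funPT.
have D0 : (\int[P]_x (D x ^+ 2)%:E = 0)%E.
  rewrite (@ae_eq_integral _ _ _ P setT (cst 0%E))//; first by rewrite integral0.
    by apply/measurable_EFinP; exact: measurable_funX.
  apply: filterS YA => x /(_ I) YX _ /=.
  by rewrite -[D x]/(X x - Y x) YX subrr expr0n.
have DL : D \in Lfun P 2%:E.
  apply/integrable_L2; split=> //; apply/integrableP; split.
    by apply/measurable_EFinP; exact: measurable_funX.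
  by under eq_integral do rewrite /= ger0_norm ?sqr_ge0//; rewrite D0 ltry.
rewrite -[LHS]/('N[P]_2%:E[EFin \o D])%E nrm_fin//; congr EFin; apply/eqP.
rewrite -sqrf_eq0 nrm_sqr// -eqe -ip_fin// expectation.unlock -[X in _ == X]D0.
by apply/eqP/eq_integral => x _; rewrite expr2.
Qed.

Hypotheses (gamma_ge0 : 0 <= gamma) (gamma_lt1 : gamma < 1).

Lemma partial_sum_fun e (A : time e -> {RV P >-> R}) N :
  partial_sum A N = \sum_(t <- times e N) gamma ^+ time_val t *: (A t : T -> R)
    :> (T -> R).
Proof. by rewrite mfun_sumE. Qed.

Lemma partial_sum_L2 e (A : time e -> {RV P >-> R}) N :
  (forall t, (A t : T -> R) \in Lfun P 2%:E) ->
  (partial_sum A N : T -> R) \in Lfun P 2%:E.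
Proof. by move=> AL; rewrite partial_sum_fun rpred_sum// => t _; rewrite rpredZ. Qed.

Lemma discounted_sum_ex e (A : time e -> {RV P >-> R}) (b : R) :
  (forall t, (A t : T -> R) \in Lfun P 2%:E) ->
  (forall t, nrm P (A t) <= b) ->
  exists2 Y : {RV P >-> R}, (Y : T -> R) \in Lfun P 2%:E &
    @discounted_sum _ _ _ P Z gamma e A Y.
Proof.
case: e A => [s|z] A AL Ab.
  (* The index 0 is arbitrary: [times] of a finite episode does not depend on it. *)
  exists (@partial_sum (Defs.Finite s) A 0); first exact: partial_sum_L2.
  exact: ae_eq_refl.
pose X t : T -> R := gamma ^+ t *: (A t : T -> R).
have XL t : X t \in Lfun P 2%:E by rewrite rpredZ.
(* The norm of gamma^t A_t is at most b gamma^t, a summable majorant. *)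
pose u := geometric b gamma.
have Xu t : nrm P (X t) <= u t.
  by rewrite nrmZ// ger0_norm ?exprn_ge0// /u /= mulrC ler_wpM2r ?exprn_ge0.
have cu : cvgn (series u) by apply: is_cvg_geometric_series; rewrite ger0_norm.
have mY := measurable_L2_series_lim XL.
pose Y : {RV P >-> R} := mfun_Sub (mem_set mY).
have [YL Yc] := L2_series_cvg XL Xu cu.
exists Y => //; rewrite /discounted_sum.
have -> : (fun n => L2norm (P := P) (\sum_(t < n) gamma ^+ t *: A t - Y)) =
    fun n => (nrm P (\sum_(0 <= t < n) X t - L2_series_lim X))%:E.
  apply/funext => n; rewrite -nrm_fin ?rpredB ?rpred_sum// /L2norm.
  have E : (\sum_(t < n) gamma ^+ t *: A t : {RV P >-> R}) = \sum_(t < n) X t :> (T -> R).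
    exact: mfun_sumE.
  by rewrite big_mkord -E.
by apply: cvg_EFin => //; exact: nearW.
Qed.

Section span.
Variables (I : Type) (X : I -> {RV P >-> R}).
Hypothesis XL : forall i, (X i : T -> R) \in Lfun P 2%:E.

Lemma L2_closed_span_partial e (i : time e -> I) (Y : {RV P >-> R}) :
  (Y : T -> R) \in Lfun P 2%:E ->
  @discounted_sum _ _ _ P Z gamma e (fun t => X (i t)) Y -> L2_closed_span X Y.
Proof.
move=> YL /discounted_sum_cvg c; split=> // eps eps0.
pose S N : {RV P >-> R} := partial_sum (fun t => X (i t)) N.
have SL N : (S N : T -> R) \in Lfun P 2%:E by apply: partial_sum_L2.
have [_ /cvgrPdist_lt/(_ _ eps0)[N _ /(_ N (leqnn N)) SY]] :=
  L2_limit (measurable_funPT Y) SL c.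
pose r := times e N.
(* The approximating combination is the partial sum S_N itself, indexed by the positions in
   [times e N]. *)
exists (size r), (fun j => gamma ^+ time_val (tnth (in_tuple r) j)),
  (fun j => i (tnth (in_tuple r) j)).
rewrite -(big_tnth _ _ r xpredT (fun t => gamma ^+ time_val t *: X (i t))).
have YSL : (Y : T -> R) - S N \in Lfun P 2%:E.
  by rewrite rpredB//; exact: SL.
suff : ('N[P]_2%:E[EFin \o ((Y : T -> R) - S N)%R] < eps%:E)%E by [].
rewrite nrm_fin// lte_fin.
rewrite -opprB -scaleN1r nrmZ; last by rewrite rpredB//; exact: SL.
rewrite normrN1 mul1r.
by move: SY; rewrite sub0r normrN ger0_norm ?nrm_ge0.
Qed.
End span.
End partial_sums.

(** * Mean, covariance and normality of the discounted sums *)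

Section discounted_sums_of_gaussians.
Context {R : realType} {d : measure_display} {T : measurableType d}.
Variables (P : probability T R) (Z : Type) (gamma : R) (k : Z -> Z -> R).
Variables (X : moment Z -> {RV P >-> R}) (mu : moment Z -> R).
Hypothesis Xgp : gaussian_process X mu (fun i j => k (step_at i) (step_at j)).

Definition moment_at (e : episode Z) (t : time e) : moment Z := existT _ e t.

Let A e (t : time e) : {RV P >-> R} := centered X mu (moment_at t).

Let AL e (t : time e) : (A t : T -> R) \in Lfun P 2%:E.
Proof. exact: centered_L2 Xgp _. Qed.

Let S e N := partial_sum gamma (@A e) N.

Let SL e N : (S e N : T -> R) \in Lfun P 2%:E.
Proof. exact: partial_sum_L2. Qed.

(** The squared norm of A_t is k(z_t, z_t). *)
Lemma nrm_advantage_le (M : R) e (t : time e) : (forall z z', `|k z z'| <= M) ->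
  nrm P (A t) <= Num.sqrt `|M|.
Proof.
move=> kM; rewrite -[leLHS]ger0_norm ?nrm_ge0// -sqrtr_sqr ler_wsqrtr//.
rewrite (nrm_centered Xgp) (le_trans (ler_norm _))// (le_trans (kM _ _))//.
exact: ler_norm.
Qed.

Lemma ip_partial_sum_cst1 e N : ip P (S e N) (cst 1) = 0.
Proof.
rewrite partial_sum_fun ip_suml ?cst_L2//; last by move=> t; rewrite rpredZ.
by apply: big1 => t _; rewrite ipZl ?cst_L2// (ip_centered_cst1 Xgp) mulr0.
Qed.

Lemma ip_partial_sum e e' N : ip P (S e N) (S e' N) =
  \sum_(t <- times e N) \sum_(u <- times e' N) discounted_term gamma k (t, u).
Proof.
rewrite !partial_sum_fun ip_suml; first last.
- by rewrite rpred_sum// => t _; rewrite rpredZ.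
- by move=> t; rewrite rpredZ.
apply: eq_bigr => t _; rewrite ip_sumr ?rpredZ//; last by move=> u; rewrite rpredZ.
apply: eq_bigr => u _; rewrite ipZl ?rpredZ// ipZr// (ip_centered Xgp) mulrA -exprD.
by [].
Qed.

Variable F : episode Z -> {RV P >-> R}.
Hypothesis FA : forall e, discounted_sum gamma (@A e) (F e).

(** Square integrability of F e comes from the convergence of the partial sums to it. *)
Let FL e : (F e : T -> R) \in Lfun P 2%:E.
Proof. exact: (L2_limit (measurable_funPT (F e)) (SL e) (discounted_sum_cvg (FA e))).1. Qed.

Let Fc e : nrm P ((S e N : T -> R) - F e) @[N --> \oo] --> 0.
Proof. exact: (L2_limit (measurable_funPT (F e)) (SL e) (discounted_sum_cvg (FA e))).2. Qed.

Lemma discounted_sum_mean e : ('E_P[F e] = 0)%E.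
Proof.
have c : ip P (S e N) (cst 1) @[N --> \oo] --> ip P (F e) (cst 1).
  by apply: ip_cvgl => //; exact: cst_L2.
have c0 : ip P (S e N) (cst 1) @[N --> \oo] --> (0 : R).
  by under eq_fun do rewrite ip_partial_sum_cst1; exact: cvg_cst.
have := cvg_unique _ c c0; rewrite ip_cst1.
by move=> E; rewrite -[LHS]fineK ?E// expectation_fin_num// L2_Lfun1.
Qed.

(** Both sides are the limit of <S_N(e), S_N(e')>: one by continuity of the inner product, the other
    by square summation. As the means vanish, the inner product of the limits is their
    covariance. *)
Lemma discounted_sum_cov e e' :
  summable [set: time e * time e'] (fun tu => (discounted_term gamma k tu)%:E) ->
  covariance P (F e) (F e') = (discounted_kernel gamma k e e')%:E.
Proof.
move=> sk.
have c : ip P (S e N) (S e' N) @[N --> \oo] --> ip P (F e) (F e') by exact: ip_cvg.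
have c' : ip P (S e N) (S e' N) @[N --> \oo] --> discounted_kernel gamma k e e'.
  by under eq_fun do rewrite ip_partial_sum; exact: discounted_kernel_cvg.
have <- : ip P (F e) (F e') = discounted_kernel gamma k e e' :=
  cvg_unique (@norm_hausdorff _ _) c c'.
rewrite -ip_fin// covariance.unlock !discounted_sum_mean /=.
by congr (expectation _ _); apply/funext => x; rewrite /= !fctE /= !subr0.
Qed.

(** The same combination of the partial sums is a finite combination of centered variables, hence
    normal, and it converges in L^2. *)
Lemma discounted_sum_normal n (a : 'I_n -> R) (i : 'I_n -> episode Z) :
  normal_law (\sum_(j < n) a j *: F (i j) : {RV P >-> R}).
Proof.
pose Y N : {RV P >-> R} := \sum_(j < n) a j *: S (i j) N.
have YE N : (Y N : T -> R) = \sum_(j < n) a j *: (S (i j) N : T -> R) by exact: mfun_sumE.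
pose G : {RV P >-> R} := \sum_(j < n) a j *: F (i j).
have GE : (G : T -> R) =
   \sum_(j < n) a j *: (F (i j) : T -> R) :> (T -> R) by exact: mfun_sumE.
apply: (@normal_law_limit _ _ _ _ Y G).
- by move=> N; rewrite YE rpred_sum// => j _; rewrite rpredZ.
- by rewrite GE rpred_sum// => j _; rewrite rpredZ.
- apply: (@cvg_dist_le _ _ (fun N => \sum_(j < n) `|a j| * nrm P ((S (i j) N : T -> R) - F (i j)))).
    move=> N; rewrite subr0 ger0_norm ?nrm_ge0//.
    have -> : (Y N : T -> R) - (G : T -> R) =
        \sum_(j < n) (a j *: (S (i j) N : T -> R) - a j *: (F (i j) : T -> R)).
      by rewrite YE sumrB; congr (_ - _); exact: GE.
    have SFL j : (S (i j) N : T -> R) - (F (i j) : T -> R) \in Lfun P 2%:E.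
      by rewrite rpredB//; exact: FL.
    under eq_bigr do rewrite -scalerBr.
    rewrite (le_trans (nrm_sum _ _))//; last by apply: ler_sum => j _; rewrite nrmZ.
    by move=> j; rewrite rpredZ.
  have {2}-> : (0 : R) = \sum_(j < n) 0 by rewrite big1.
  apply: cvg_big; [exact: add_continuous|move=> j _]; rewrite -[X in _ --> X](mulr0 `|a j|).
  by apply: cvgM => //; exact: cvg_cst.
- move=> N.
  (* The double sum over j and the times of [i j] is flattened into one list of weighted moments. *)
  have -> : Y N = \sum_(p <- [seq (a j * gamma ^+ time_val t, moment_at t) |
      j <- index_enum 'I_n, t <- times (i j) N]) p.1 *: centered X mu p.2.
    rewrite big_allpairs_dep; apply: eq_bigr => j _.
    by rewrite /S /partial_sum scaler_sumr; apply: eq_bigr => t _; rewrite scalerA.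
  exact: centered_combination Xgp _.
Qed.

End discounted_sums_of_gaussians.

Unset Implicit Arguments.
Set Strict Implicit.

Theorem proposition2 (R : realType) (d : measure_display)
    (T : measurableType d) (P : probability T R) (S A : Type)
    (gamma : R) (gamma_gt0 : 0 < gamma) (gamma_lt1 : gamma < 1)
    (V : S -> R) (k : S * A -> S * A -> R)
    (k_pd : positive_definite_kernel k)
    (k_bounded : exists M : R, forall z z' : S * A, `|k z z'| <= M)
    (Ret : forall e : episode (S * A), time e -> {RV P >-> R})
    (Ret_gp : gaussian_process
       (fun i : moment (S * A) => Ret (tag i) (tagged i))
       (fun i => V (step_at i).1)
       (fun i j => k (step_at i) (step_at j))) :
  (forall e : episode (S * A), exists2 Y : {RV P >-> R},
      L2_closed_span (fun i : moment (S * A) =>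
        advantage V Ret (tagged i)) Y &
      discounted_sum gamma (advantage V Ret (e := e)) Y) /\
  (forall e e' : episode (S * A),
      summable [set: time e * time e']
        (fun tu => (discounted_term gamma k tu)%:E)) /\
  (forall F : episode (S * A) -> {RV P >-> R},
      (forall e, discounted_sum gamma (advantage V Ret (e := e)) (F e)) ->
      gaussian_process F (fun=> 0) (discounted_kernel gamma k)).
Proof.
have [M kM] := k_bounded; have gamma_ge0 := ltW gamma_gt0.
have sk e e' := summable_discounted_term gamma_ge0 gamma_lt1 e e' kM.
split; [|split=> //].
- move=> e; have AL i := centered_L2 Ret_gp i.
  (* [advantage V Ret] unfolds to [centered] of the process indexed by moments, so the L^2
     membership and the uniform bound apply to it directly. *)
  have [Y YL YA] := @discounted_sum_ex _ _ _ P _ _ gamma_ge0 gamma_lt1 e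
    (advantage V Ret (e := e)) _ (fun t => AL (moment_at t))
    (fun t => nrm_advantage_le Ret_gp t kM).
  exists Y; last exact: YA.
  exact: (L2_closed_span_partial (i := @moment_at _ e) AL YL YA).
- move=> F FA n i; split.
  + by move=> a; exact: (discounted_sum_normal Ret_gp FA).
  + by move=> j; exact: (discounted_sum_mean Ret_gp FA).
  + by move=> j l; exact: (discounted_sum_cov Ret_gp FA).
Qed.
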